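(* Let $b\ge 2$ and let $n_1,\ldots,n_b$ be positive integers. Let $\Delta$ be the squared distance matrix of the starlike block graph $\mathcal{S}(n_1,n_2,\ldots,n_b)$ and let $\Delta_{22}$ be the principal submatrix of $\Delta$ obtained by deleting the row and column corresponding to the central cut vertex. Then $$\operatorname{cof}\Delta=(-1)^{\sum_{i=1}^{b}n_i}\left[\prod_{i=1}^b(3n_i+1)-2\sum_{i=1}^b n_i\prod_{j\ne i}(3n_j+1)\right]$$ and $$\operatorname{cof}\Delta_{22}=(-1)^{\sum_{i=1}^b n_i-1}\left(\sum_{i=1}^b n_i\prod_{j\ne i}(3n_j+1)\right).$$
   Context: The starlike block graph $\mathcal{S}(n_1,\ldots,n_b)$ is the graph consisting of $b\ge 2$ blocks which are the complete graphs $K_{n_1+1},\ldots,K_{n_b+1}$ (each $n_i\ge 1$), all sharing exactly one common vertex, the central cut vertex. It has $n=1+\sum_{i=1}^b n_i$ vertices. For a simple connected graph $G$ with vertices $v_1,\ldots,v_n$, the squared distance matrix is $\Delta(G)=[d(v_i,v_j)^2]$, where $d$ is the shortest-path distance. For a square matrix $A$, $\operatorname{cof}A$ denotes the sum of all cofactors of $A$, i.e. $\operatorname{cof}A=\sum_{i,j}(-1)^{i+j}\det A(i\mid j)$, where $A(i\mid j)$ is obtained by deleting row $i$ and column $j$. In $\prod_{j\neq i}$ the index $j$ runs over $\{1,\ldots,b\}\setminus\{i\}$. *)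

(* Defs.v *)
From HB Require Import structures.
From mathcomp Require Import all_boot all_order all_algebra.

Set Implicit Arguments.
Unset Strict Implicit.
Unset Printing Implicit Defensive.

Import GRing.Theory.
Local Open Scope ring_scope.

Definition walk (T : finType) (e : rel T) (x y : T) (k : nat) : bool :=
  [exists p : k.-tuple T, path e x p && (last x p == y)].

(* A shortest walk visits distinct vertices, so it has fewer than #|T| edges;
   [find] returns the least such length, and #|T| if y is unreachable from x. *)
Definition gdist (T : finType) (e : rel T) (x y : T) : nat :=
  find (walk e x y) (iota 0 #|T|).

Lemma gdist_walk (T : finType) (e : rel T) (x y : T) :
  connect e x y -> walk e x y (gdist e x y).
Proof.
case/connectP=> p0 /shortenP[p e_p Up _] ->.
have lt_p: (size p < #|T|)%N.
  by rewrite -[(_ < _)%N]/(size (x :: p) <= _)%N -(card_uniqP Up) max_card.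
have has_w: has (walk e x (last x p)) (iota 0 #|T|).
  apply/hasP; exists (size p); first by rewrite mem_iota.
  by apply/existsP; exists (in_tuple p); rewrite e_p eqxx.
have := nth_find 0 has_w; rewrite nth_iota //.
by move: has_w; rewrite has_find size_iota.
Qed.

Lemma gdist_min (T : finType) (e : rel T) (x : T) (p : seq T) :
  path e x p -> (gdist e x (last x p) <= size p)%N.
Proof.
move=> e_p; rewrite leqNgt; apply/negP => lt_d.
have lt_p: (size p < #|T|)%N.
  by apply: leq_trans lt_d _; rewrite -[leqRHS](size_iota 0) find_size.
have := before_find 0 lt_d; rewrite nth_iota // add0n => /negbT/negP[]; rewrite /walk.
by apply/existsP; exists (in_tuple p); rewrite e_p eqxx.
Qed.

(* The vertex order v_1, ..., v_n is the canonical enumeration of T. *)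
Definition sqdist_mx (T : finType) (e : rel T) : 'M[int]_#|T| :=
  \matrix_(i, j) ((gdist e (enum_val i) (enum_val j)) ^ 2)%:Z.

Definition cof (R : comNzRingType) (m : nat) (A : 'M[R]_m) : R :=
  \sum_(i < m) \sum_(j < m) cofactor A i j.

(* None is the central cut vertex; Some (Tagged _ k) with tag i is the k-th of
   the n i remaining vertices of the i-th block. *)
Definition star_vertex (b : nat) (n : 'I_b -> nat) : finType :=
  option {i : 'I_b & 'I_(n i)}.

Definition star_center (b : nat) (n : 'I_b -> nat) : star_vertex n := None.

Definition star_block (b : nat) (n : 'I_b -> nat) (i : 'I_b) :
    {set star_vertex n} :=
  [set x | if x is Some u then tag u == i else true].

(* Each block spans a complete graph K_(n i + 1), and these are all the edges. *)
Definition star_adj (b : nat) (n : 'I_b -> nat) : rel (star_vertex n) :=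
  fun x y => (x != y) &&
    [exists i, (x \in star_block n i) && (y \in star_block n i)].

Definition star_sqdist (b : nat) (n : 'I_b -> nat) :
    'M[int]_#|star_vertex n| :=
  sqdist_mx (@star_adj b n).

Definition star_sqdist22 (b : nat) (n : 'I_b -> nat) :
    'M[int]_#|star_vertex n|.-1 :=
  let c := enum_rank (star_center n) in row' c (col' c (star_sqdist n)).

(* Main.v *)
Require Import Defs.
From HB Require Import structures.
From mathcomp Require Import all_boot all_order all_algebra.
Set Implicit Arguments.
Unset Strict Implicit.
Unset Printing Implicit Defensive.
Import GRing.Theory.
Local Open Scope ring_scope.

(** Off the central vertex, the squared distance of two vertices is 0 if they
    coincide, 1 if they share a block and 4 otherwise, so the entry at (k, l)
    is 4 - 3 [k ~ l] - [k = l], where k ~ l means that the blocks agree. If U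
    is the 0/1 incidence matrix of the vertices in the blocks and J is the
    all-ones matrix, then Delta22 = 4 J - I - 3 U U^T, and both cofactor sums
    come down to the determinants of t J - I - 3 U U^T for particular t.

    As J = U J U^T, this matrix is - (I + U (3 I - t J) U^T), and the identity
    det (I + X Y) = det (I + Y X) ([det_block_addM1]) shrinks it to size b.
    Since U^T U is the diagonal matrix of the n_i, what remains is a diagonal
    matrix with entries 3 n_i + 1 plus a matrix of rank one, whence
    det (t J - I - 3 U U^T) = (-1)^N (P - t S) ([det_label_mx]), with N the sum
    of the n_i, P the product of the 3 n_i + 1, and S the sum of the
    n_i P / (3 n_i + 1).

    The cofactor sums enter through the matrix determinant lemma
    det (A + u v) = det A + v adj(A) u ([det_rank1_update]), which gives
    cof A = det (A + J) - det A ([cofE_det]). For Delta22 this is a difference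
    of the values at t = 5 and t = 4, namely - (-1)^N S. For Delta, subtracting
    row and column c from all the others turns cof A into the determinant of
    the matrix of a_kl - a_kc - a_cl + a_cc with k, l <> c ([cof_pivot]). When
    c is the centre, this subtracts 1 + 1 from each entry of Delta22, which is
    the value at t = 2, (-1)^N (P - 2 S). *)

(** * Determinants of low-rank updates *)

(** The Schur complement of the identity block. *)
Lemma det_block_addM (R : comNzRingType) (m p : nat)
    (A : 'M[R]_m) (U : 'M_(m, p)) (V : 'M_(p, m)) :
  \det (block_mx A (- U) V 1%:M) = \det (A + U *m V).
Proof.
have : block_mx 1%:M U 0 1%:M *m block_mx A (- U) V 1%:M
    = block_mx (A + U *m V) 0 V 1%:M.
  by rewrite mulmx_block !mul1mx !mul0mx !mulmx1 !add0r addNr.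
move/(congr1 determinant); rewrite det_mulmx det_ublock det_lblock.
by rewrite !det1 !mul1r mulr1.
Qed.

(** Sylvester's identity: the two Schur complements of one block matrix have the
    same determinant. *)
Lemma det_block_addM1 (R : comNzRingType) (m p : nat)
    (U : 'M[R]_(m, p)) (V : 'M_(p, m)) :
  \det (1%:M + U *m V) = \det (1%:M + V *m U).
Proof.
rewrite -det_block_addM.
have <- : block_mx 1%:M 0 V 1%:M *m block_mx 1%:M (- U) 0 (1%:M + V *m U)
    = block_mx 1%:M (- U) V 1%:M.
  rewrite mulmx_block !mulmx1 !mul1mx !mul0mx !addr0.
  by rewrite mulmxN [1%:M + _]addrC addKr.
by rewrite det_mulmx det_lblock det_ublock !det1 !mul1r.
Qed.

(** Multiplying the block matrix (A, -u; v, 1) by (1, C u; 0, det A) clears its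
    upper right block, which proves the formula up to a factor det A. Leaving C
    free allows an explicit substitute for the adjugate. *)
Lemma det_rank1_update_lreg (R : comNzRingType) (m : nat) (A C : 'M[R]_m)
    (u : 'cV_m) (v : 'rV_m) :
    GRing.lreg (\det A) -> A *m C = (\det A)%:M ->
  \det (A + u *m v) = \det A + (v *m C *m u) 0 0.
Proof.
move=> regA AC; apply: regA; rewrite -det_block_addM mulrC.
set d := \det A.
have dE : d = \det (block_mx 1%:M (C *m u) 0 d%:M :> 'M_(m + 1)).
  by rewrite det_ublock det1 mul1r det_mx11 mxE eqxx.
rewrite [X in _ * X = _]dE -det_mulmx mulmx_block !mulmx1 !mulmx0 !addr0.
rewrite mulmxA AC !mul1mx mul_mx_scalar mul_scalar_mx scalerN subrr det_lblock; congr (_ * _).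
by rewrite det_mx11 addrC mulmxA !mxE eqxx.
Qed.

(** The matrix determinant lemma over any commutative ring: the determinant of
    A + X is a monic polynomial, hence regular, and the formula for A + X
    specializes to the one for A at X = 0. *)
Lemma det_rank1_update (R : comNzRingType) (m : nat) (A : 'M[R]_m)
    (u : 'cV_m) (v : 'rV_m) :
  \det (A + u *m v) = \det A + (v *m \adj A *m u) 0 0.
Proof.
pose B := char_poly_mx (- A).
pose ev : {rmorphism {poly R} -> R} := horner_eval 0.
have evC k l (M : 'M[R]_(k, l)) : map_mx ev (map_mx polyC M) = M.
  by apply/matrixP => i j; rewrite !mxE /= /horner_eval hornerC.
have evB : map_mx ev B = A.
  apply/matrixP => i j; rewrite !mxE /= /horner_eval !hornerE.
  by case: (i == j); rewrite ?mulr1n ?mulr0n !hornerE ?opprK ?add0r.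
have regB : GRing.lreg (\det B) := monic_lreg (char_poly_monic (- A)).
have := det_rank1_update_lreg (map_mx polyC u) (map_mx polyC v) regB
  (mul_mx_adj B).
move/(congr1 ev); rewrite rmorphD /= -!det_map_mx map_mxD map_mxM !evC evB => ->.
have -> (M : 'M[{poly R}]_1) : ev (M 0 0) = map_mx ev M 0 0 by rewrite mxE.
by rewrite !map_mxM !evC map_mx_adj evB.
Qed.

Lemma det_diag_rank1_update (R : idomainType) (b : nat) (d : 'I_b -> R)
    (u : 'cV_b) (v : 'rV_b) : (forall i, d i != 0) ->
  \det (diag_mx (\row_i d i) + u *m v) =
  \prod_i d i + \sum_i v 0 i * u i 0 * \prod_(j | j != i) d j.
Proof.
move=> d_neq0; set D := diag_mx _.
(* C is the adjugate of D. *)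
pose C : 'M_b := diag_mx (\row_i \prod_(j | j != i) d j).
have detD : \det D = \prod_i d i.
  by rewrite det_diag; apply: eq_bigr => i _; rewrite mxE.
rewrite (@det_rank1_update_lreg _ _ _ C).
- rewrite detD mxE; congr (_ + _); apply: eq_bigr => i _.
  by rewrite mul_mx_diag !mxE mulrAC.
- by rewrite detD; apply/lregP/prodf_neq0 => i _.
rewrite detD; apply/matrixP => i j; rewrite mul_diag_mx !mxE.
by case: eqP => [->|_]; rewrite ?mulr0 // mulr1n [in RHS](bigD1 j).
Qed.

(** * Sums of cofactors *)

Lemma cofE_det (R : comNzRingType) (m : nat) (A : 'M[R]_m) :
  cof A = \det (A + const_mx 1) - \det A.
Proof.
have -> : const_mx 1 = (const_mx 1 : 'cV[R]_m) *m (const_mx 1 : 'rV_m).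
  by apply/matrixP => i j; rewrite !mxE big_ord1 !mxE mulr1.
rewrite det_rank1_update addrC addKr mxE; apply: eq_bigr => i _.
rewrite !mxE mulr1; apply: eq_bigr => j _.
by rewrite !mxE mul1r.
Qed.

(** Let P be the matrix subtracting row c from all the other rows. It has
    determinant 1 and sends the all-ones vector to the basis vector e of index
    c, so P (A + J) P^T = P A P^T + e e^T: the difference of determinants in
    [cofE_det] becomes the single cofactor of P A P^T at (c, c). *)
Lemma cof_pivot (R : comNzRingType) (m : nat) (A : 'M[R]_m) (c : 'I_m) :
  cof A = \det (\matrix_(k, l)
    (A (lift c k) (lift c l) - A (lift c k) c - A c (lift c l) + A c c)).
Proof.
pose e : 'cV[R]_m := delta_mx c 0; pose J1 : 'cV[R]_m := const_mx 1.
pose P := 1%:M + (e - J1) *m e^T.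
have ee : e^T *m e = 1%:M.
  by rewrite trmx_delta mul_delta_mx; apply/matrixP => i j; rewrite !mxE !ord1.
have eJ : e^T *m J1 = 1%:M.
  by rewrite trmx_delta -rowE; apply/matrixP => i j; rewrite !mxE !ord1.
have PJ : P *m J1 = e.
  by rewrite mulmxDl mul1mx -mulmxA eJ mulmx1 addrC subrK.
have detP : \det P = 1.
  by rewrite det_block_addM1 mulmxBr ee eJ subrr addr0 det1.
have PE (k : 'I_m.-1) (p : nat) (M : 'M_(m, p)) j :
    (P *m M) (lift c k) j = M (lift c k) j - M c j.
  rewrite mulmxDl mul1mx -mulmxA trmx_delta -rowE mulmxBl.
  rewrite !mxE big_ord1 !mxE /= big_ord1 !mxE.
  by rewrite eq_sym (negPf (neq_lift c k)) mul0r mul1r add0r.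
have PEr q (k : 'I_m.-1) (M : 'M_(q, m)) i :
    (M *m P^T) i (lift c k) = M i (lift c k) - M i c.
  by rewrite -[M *m _]trmxK trmx_mul trmxK mxE PE !mxE.
pose M := P *m A *m P^T.
have detPP (B : 'M_m) : \det B = \det (P *m B *m P^T).
  by rewrite !det_mulmx det_tr detP mulr1 mul1r.
rewrite cofE_det detPP [in X in _ - X]detPP mulmxDr mulmxDl.
have -> : const_mx 1 = J1 *m J1^T.
  by apply/matrixP => i j; rewrite !mxE big_ord1 !mxE mulr1.
rewrite mulmxA PJ -[e *m _ *m _]mulmxA -trmx_mul PJ.
rewrite det_rank1_update addrC addKr -/M.
(* e^T adj(M) e is the cofactor of M at (c, c), of sign (-1)^(c + c). *)
rewrite trmx_delta -rowE -colE !mxE /cofactor addnn -mul2n exprM sqrrN expr1n.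
rewrite expr1n mul1r; congr (\det _); apply/matrixP => k l.
rewrite [RHS]mxE [LHS]mxE [LHS]mxE /M PEr !PE.
by rewrite opprB addrA addrAC; congr (_ + _); apply: addrAC.
Qed.

(** * The determinant of a matrix determined by block labels *)

(** The matrix is t J - I - s U U^T for the incidence matrix U of the labels;
    Sylvester's identity moves the computation from the N indices to the b
    labels. *)
Lemma det_label_mx (N b : nat) (beta : 'I_N -> 'I_b) (n : 'I_b -> nat)
    (s t : int) :
    (forall i, n i = \sum_k (beta k == i))%N ->
    (forall i, s * (n i)%:Z + 1 != 0) ->
  \det (\matrix_(k, l) (t - s * (beta k == beta l)%:R - (k == l)%:R)) =
  (-1) ^+ N * (\prod_(i < b) (s * (n i)%:Z + 1)
    - t * \sum_(i < b) (n i)%:Z * \prod_(j < b | j != i) (s * (n j)%:Z + 1)).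
Proof.
move=> nE x_neq0.
pose U : 'M[int]_(N, b) := \matrix_(k, i) (beta k == i)%:R.
pose w : 'rV_b := \row_i (n i)%:Z.
have rowU (k : 'I_N) p (M : 'M_(b, p)) j : (U *m M) k j = M (beta k) j.
  rewrite mxE (bigD1 (beta k)) //= mxE eqxx mul1r big1 ?addr0 // => i.
  by rewrite mxE eq_sym => /negPf ->; rewrite mul0r.
have UU : U^T *m U = diag_mx w.
  apply/matrixP => i j; rewrite !mxE nE.
  rewrite (eq_bigr (fun k => ((beta k == i)%N%:Z) *+ (i == j))) => [|k _].
    by rewrite sumrMnl (big_morph Posz PoszD (erefl _)).
  rewrite !mxE; case: (beta k =P i) => [->|_]; last by rewrite mul0r mul0rn.
  by rewrite mul1r.
pose Y : 'M[int]_b := s%:M - const_mx t.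
have UYU : U *m (Y *m U^T) = \matrix_(k, l) (s * (beta k == beta l)%:R - t).
  apply/matrixP => k l; rewrite rowU -[Y *m _]trmxK trmx_mul trmxK mxE rowU.
  by rewrite !mxE mulr_natr.
have -> : \matrix_(k, l) (t - s * (beta k == beta l)%:R - (k == l)%:R)
    = -1 *: (1%:M + U *m (Y *m U^T)).
  by apply/matrixP => k l; rewrite UYU !mxE mulN1r opprD opprB addrC.
rewrite detZ det_block_addM1 -mulmxA UU; congr (_ * _).
have -> : 1%:M + Y *m diag_mx w
    = diag_mx (\row_i (s * (n i)%:Z + 1)) + const_mx 1 *m (- t *: w).
  apply/matrixP => i j; rewrite mul_mx_diag !mxE big_ord1 !mxE mul1r mulrBl.
  rewrite mulNr addrA; congr (_ - _).
  by case: eqP => [->|_]; rewrite ?mulr1n ?mulr0n ?mul0r ?addr0 // addrC.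
rewrite det_diag_rank1_update //; congr (_ + _); rewrite mulr_sumr -sumrN.
by apply: eq_bigr => i _; rewrite !mxE mulr1 !mulNr mulrA.
Qed.

(** * Distances in the starlike block graph *)

Lemma gdistxx (T : finType) (e : rel T) (x : T) : gdist e x x = 0.
Proof. by apply/eqP; rewrite -leqn0; apply: (@gdist_min _ _ _ [::]). Qed.

Lemma gdist_eq0 (T : finType) (e : rel T) (x y : T) :
  connect e x y -> gdist e x y = 0 -> x = y.
Proof.
move=> /gdist_walk + d0; rewrite d0 => /existsP[p].
by rewrite tuple0 => /eqP.
Qed.

Lemma gdist_edge (T : finType) (e : rel T) (x y : T) :
  x != y -> e x y -> gdist e x y = 1.
Proof.
move=> neq_xy exy; have le1 : (gdist e x y <= 1)%N.
  by apply: (@gdist_min _ _ _ [:: y]); rewrite /= exy.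
apply/eqP; rewrite eqn_leq le1 lt0n; apply: contra neq_xy => /eqP d0.
exact/eqP/(gdist_eq0 (connect1 exy)).
Qed.

Lemma gdist_eq2 (T : finType) (e : rel T) (x z y : T) :
  x != y -> ~~ e x y -> e x z -> e z y -> gdist e x y = 2.
Proof.
move=> neq_xy nexy exz ezy; have le2 : (gdist e x y <= 2)%N.
  by apply: (@gdist_min _ _ _ [:: z; y]); rewrite /= exz ezy.
have cxy := connect_trans (connect1 exz) (connect1 ezy).
case: (ltngtP (gdist e x y) 2) le2 => //.
rewrite ltnS leq_eqVlt ltnS leqn0 => /orP[] /eqP d _; last first.
  by rewrite (gdist_eq0 cxy d) eqxx in neq_xy.
have := gdist_walk cxy; rewrite d => /existsP[p].
case/tupleP: p => a p; rewrite tuple0 /= andbT => /andP[exa /eqP ay].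
by rewrite -ay exa in nexy.
Qed.

Lemma star_adjNS (b : nat) (n : 'I_b -> nat) (u : {i : 'I_b & 'I_(n i)}) :
  star_adj (None : star_vertex n) (Some u) &&
  star_adj (Some u) (None : star_vertex n).
Proof.
by apply/andP; split; apply/andP; split => //; apply/existsP; exists (tag u);
  rewrite !inE eqxx.
Qed.

Lemma star_adjSS (b : nat) (n : 'I_b -> nat) (u v : {i : 'I_b & 'I_(n i)}) :
  star_adj (Some u : star_vertex n) (Some v) = (u != v) && (tag u == tag v).
Proof.
congr (_ && _); apply/existsP/eqP => [[i]|uv].
  by rewrite !inE => /andP[/eqP-> /eqP].
by exists (tag u); rewrite !inE uv eqxx.
Qed.

Lemma star_gdistSS (b : nat) (n : 'I_b -> nat) (u v : {i : 'I_b & 'I_(n i)}) :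
  gdist (@star_adj b n) (Some u) (Some v) =
  if u == v then 0 else if tag u == tag v then 1 else 2.
Proof.
case: eqVneq => [->|neq_uv]; first exact: gdistxx.
case: ifP => tuv; first by apply: gdist_edge => //; rewrite star_adjSS neq_uv.
have /andP[_ uN] := star_adjNS u; have /andP[Nv _] := star_adjNS v.
by apply: (gdist_eq2 _ _ uN Nv) => //; rewrite star_adjSS tuv andbF.
Qed.

Lemma star_gdistNS (b : nat) (n : 'I_b -> nat) (u : {i : 'I_b & 'I_(n i)}) :
  gdist (@star_adj b n) None (Some u) = 1 /\
  gdist (@star_adj b n) (Some u) None = 1.
Proof. by have /andP[Nu uN] := star_adjNS u; split; apply: gdist_edge. Qed.

Lemma star_sqdistSS (b : nat) (n : 'I_b -> nat) (u v : {i : 'I_b & 'I_(n i)}) :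
  ((gdist (@star_adj b n) (Some u) (Some v)) ^ 2)%:Z =
  4 - 3 * (tag u == tag v)%:R - (u == v)%:R.
Proof.
by rewrite star_gdistSS; case: eqVneq => [->|_]; rewrite ?eqxx //; case: ifP.
Qed.

(** Deleting the row and column of the centre leaves a matrix indexed by
    ordinals; f names the vertex behind each of them. *)
Lemma star_noncentral_bij (b : nat) (n : 'I_b -> nat) :
  exists2 f : 'I_(#|star_vertex n|.-1) -> {i : 'I_b & 'I_(n i)},
    bijective f &
    forall k, enum_val (lift (enum_rank (star_center n)) k) = Some (f k).
Proof.
set c := enum_rank _.
have /fin_all_exists[f fE] : forall k, exists u : {i : 'I_b & 'I_(n i)},
    enum_val (lift c k) = Some u.
  move=> k; case E: (enum_val (lift c k)) => [u|]; first by exists u.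
  by have := neq_lift c k; rewrite -(inj_eq enum_val_inj) E enum_rankK.
exists f => //; apply: inj_card_bij; last by rewrite card_ord card_option.
by move=> k l fkl; apply: (@lift_inj _ c); apply: enum_val_inj; rewrite !fE fkl.
Qed.

Lemma sum_tagged (b : nat) (n : 'I_b -> nat) (F : 'I_b -> nat) :
  (\sum_(u : {i : 'I_b & 'I_(n i)}) F (tag u) = \sum_(i < b) n i * F i)%N.
Proof.
transitivity (\sum_(i < b) \sum_(j < n i) F i)%N.
  by rewrite sig_big_dep.
by apply: eq_bigr => i _; rewrite sum_nat_const card_ord.
Qed.

(** * The cofactor sums *)

Theorem theorem2p7 (b : nat) (n : 'I_b -> nat)
    (hb : (2 <= b)%N) (hn : forall i : 'I_b, (0 < n i)%N) :
  cof (star_sqdist n) =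
    (-1) ^+ (\sum_(i < b) n i)%N *
      (\prod_(i < b) (3 * (n i)%:Z + 1)
       - 2 * \sum_(i < b) (n i)%:Z * \prod_(j < b | j != i) (3 * (n j)%:Z + 1))
  /\
  cof (star_sqdist22 n) =
    (-1) ^+ ((\sum_(i < b) n i) - 1)%N *
      (\sum_(i < b) (n i)%:Z * \prod_(j < b | j != i) (3 * (n j)%:Z + 1)).
Proof.
have [f bij_f fE] := star_noncentral_bij n.
set c := enum_rank _ in fE.
have cE : enum_val c = star_center n by rewrite enum_rankK.
have NE : #|star_vertex n|.-1 = (\sum_(i < b) n i)%N.
  rewrite card_option /= -sum1_card (sum_tagged n (fun=> 1)).
  by apply: eq_bigr => i _; rewrite muln1.
have nE i : n i = (\sum_k (tag (f k) == i))%N.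
  have := sum_tagged n (fun j => (j == i : nat)).
  rewrite (reindex f (onW_bij _ bij_f)) => ->.
  rewrite (bigD1 i) //= eqxx muln1 big1 ?addn0 // => j /negPf ->.
  by rewrite muln0.
have d_neq0 i : 3 * (n i)%:Z + 1 != 0.
  by rewrite -[3]/(3%N%:Z) -PoszM -PoszD addn1.
have labelE t := det_label_mx t nE d_neq0.
have sqdistE k l : star_sqdist n (lift c k) (lift c l) =
    4 - 3 * (tag (f k) == tag (f l))%:R - (k == l)%:R.
  by rewrite mxE !fE star_sqdistSS (bij_eq bij_f).
split.
  rewrite (cof_pivot _ c) -NE -labelE; congr (\det _).
  apply/matrixP => k l; rewrite mxE sqdistE !mxE cE !fE gdistxx.
  rewrite (star_gdistNS (f k)).2 (star_gdistNS (f l)).1.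
  by case: eqP; case: eqP.
have S_gt0 : (0 < \sum_(i < b) n i)%N.
  by rewrite (bigD1 (Ordinal hb)) //= ltn_addr.
rewrite cofE_det.
have -> : star_sqdist22 n = \matrix_(k, l)
    (4 - 3 * (tag (f k) == tag (f l))%:R - (k == l)%:R).
  by apply/matrixP => k l; rewrite [RHS]mxE -sqdistE /star_sqdist22 2!mxE.
have -> : \matrix_(k, l) (4 - 3 * (tag (f k) == tag (f l))%:R - (k == l)%:R)
    + const_mx 1 = \matrix_(k, l)
    (5 - 3 * (tag (f k) == tag (f l))%:R - (k == l)%:R) :> 'M[int]_(_).
  by apply/matrixP => k l; rewrite !mxE; case: eqP; case: eqP.
(* One sign is split off (-1) ^+ N, which needs N > 0. *)
rewrite !labelE NE -mulrBr -{1}(subnK S_gt0) exprD expr1 mulrN1 mulNr -mulrN.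
congr (_ * _); set S := \sum_(i < b) _; rewrite opprB opprB addrA addrC.
by rewrite addrA addKr -mulNr -mulrDl mul1r.
Qed.
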